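(* Let $k\ge2$ and consider the NODE system $\dot x_{nn}=Ax_{nn}+Z_{nn}(x_{nn})$ on $\mathbb{R}^n$, where $Z_{nn}$ is a $k$-hidden-layer feedforward network whose activation functions are incrementally sector bounded by $[K_1^i,K_2^i]$, $i=1,\dots,k$. Let $\mathcal{C}\subseteq\mathcal{D}$ be a set on which the system is forward complete and forward invariant. Suppose there exist a positive definite matrix $P\in\mathbb{R}^{n\times n}$ and positive constants $\underline{p},\overline{p},\gamma$ such that $\underline{p}I\le P\le\overline{p}I$ and $$U_1^\top\begin{bmatrix}A^\top P+PA+\gamma P & PW^{k+1}\\ W^{(k+1)\top}P & 0\end{bmatrix}U_1+U_2^\top\begin{bmatrix}-2Q_1^\top Q_2 & Q_1^\top+Q_2^\top\\ Q_1+Q_2 & -2I\end{bmatrix}U_2\le0 .$$ Then the NODE system is contractive in $\mathcal{C}$.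
   Context: Network. $n=m_0=m_{k+1}$, $A\in\mathbb{R}^{n\times n}$. For input $x\in\mathbb{R}^n$: $w^0=x$, $w^{i+1}=\phi^{i+1}(W^{i+1}w^i+b^{i+1})$ for $i=0,\dots,k-1$, and $Z_{nn}(x)=W^{k+1}w^k+b^{k+1}$, with $W^{i+1}\in\mathbb{R}^{m_{i+1}\times m_i}$, $b^{i+1}\in\mathbb{R}^{m_{i+1}}$. Each $\phi^i:\mathbb{R}^{m_i}\to\mathbb{R}^{m_i}$ acts componentwise through differentiable scalar activation functions $\varphi^i_j$, $j=1,\dots,m_i$. $\mathcal{D}\subseteq\mathbb{R}^n$ is a given set of states. Incremental sector bound $[K_1^i,K_2^i]$: $K_1^i=\mathrm{diag}(\alpha^i_1,\dots,\alpha^i_{m_i})$, $K_2^i=\mathrm{diag}(\beta^i_1,\dots,\beta^i_{m_i})$ with $\alpha^i_j\le\beta^i_j$ real, and $(\varphi^i_j(s)-\varphi^i_j(t)-\alpha^i_j(s-t))(\varphi^i_j(s)-\varphi^i_j(t)-\beta^i_j(s-t))\le0$ for all $s,t$ in the set of values of the $j$-th component of $W^iw^{i-1}+b^i$ as the network input $x$ ranges over $\mathcal{D}$. Matrices. $Q_1=\mathrm{blockdiag}(K_1^1W^1,\dots,K_1^kW^k)$, $Q_2=\mathrm{blockdiag}(K_2^1W^1,\dots,K_2^kW^k)$; $a=\sum_{i=1}^{k-1}m_i$; $$U_1=\begin{bmatrix}I_n&0_{n\times a}&0_{n\times m_k}\\0_{m_k\times n}&0_{m_k\times a}&I_{m_k}\end{bmatrix},\qquad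 U_2=\begin{bmatrix}I_n&0_{n\times a}&0_{n\times m_k}\\0_{a\times n}&I_a&0_{a\times m_k}\\0_{a\times n}&I_a&0_{a\times m_k}\\0_{m_k\times n}&0_{m_k\times a}&I_{m_k}\end{bmatrix}.$$ Forward complete and forward invariant on $\mathcal{C}$: for any $x_{nn}(0)\in\mathcal{C}$ the trajectory exists and satisfies $x_{nn}(t)\in\mathcal{C}$ for all $t\ge0$. Contractive in a forward invariant set $\mathcal{C}$: there exist $c>0$, $\rho>0$ such that any two solutions with initial conditions in $\mathcal{C}$ satisfy $\|x_{nn1}(t)-x_{nn2}(t)\|\le ce^{-\rho t}\|x_{nn1}(0)-x_{nn2}(0)\|$ for all $t\ge0$ ($\|\cdot\|$ a fixed norm on $\mathbb{R}^n$). For symmetric matrices, $B\le C$ means $B-C$ is negative semidefinite. *)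

(* Defs.v *)
From HB Require Import structures.
From mathcomp Require Import all_boot all_order all_algebra.
From mathcomp Require Import all_classical all_reals all_analysis.
Set Implicit Arguments.
Unset Strict Implicit.
Unset Printing Implicit Defensive.
Import Order.TTheory GRing.Theory Num.Theory.
Import numFieldNormedType.Exports.
Local Open Scope classical_set_scope.
Local Open Scope ring_scope.

(* [layer_dim n m i] is m_i, with m_0 = n by computation; [m 0] is not used. *)
Definition layer_dim (n : nat) (m : nat -> nat) (i : nat) : nat :=
  if i is j.+1 then m j.+1 else n.

(* a = m_1 + ... + m_(k-1), for layer dimensions d *)
Definition inner_dim (d : nat -> nat) (k : nat) : nat :=
  (\sum_(1 <= i < k) d i)%N.

Lemma sum_rows (d : nat -> nat) (k : nat) : (1 < k)%N ->
  (\sum_(i < k) d i.+1 = inner_dim d k + d k)%N.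
Proof.
by case: k => [//|k _]; rewrite big_ord_recr /inner_dim big_add1 big_mkord.
Qed.

Lemma sum_cols (d : nat -> nat) (k : nat) : (1 < k)%N ->
  (\sum_(i < k) d i = d 0 + inner_dim d k)%N.
Proof.
by case: k => [//|k _]; rewrite big_ord_recl /inner_dim big_add1 big_mkord.
Qed.

(* A feedforward network R^n -> R^n with k hidden layers of widths
   m_1, ..., m_k. The fields are 0-based: [weight i] is W^{i+1}, [bias i] is
   b^{i+1}, and [activ j] is the activation of neuron j of layer i+1 (with i
   implicit). Only the values at i < k matter; [out_weight] is W^{k+1} and
   [out_bias] is b^{k+1}. *)
Record network (R : realType) (n k : nat) := Network {
  hidden : nat -> nat;
  weight : forall i, 'M[R]_(layer_dim n hidden i.+1, layer_dim n hidden i);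
  bias : forall i, 'cV[R]_(layer_dim n hidden i.+1);
  activ : forall i, 'I_(layer_dim n hidden i.+1) -> R -> R;
  out_weight : 'M[R]_(n, layer_dim n hidden k);
  out_bias : 'cV[R]_n
}.

Section Network.
Variables (R : realType) (n k : nat) (N : network R n k).

Local Notation m := (layer_dim n (hidden N)).
Local Notation a := (inner_dim m k).

(* w^i *)
Fixpoint layer (x : 'cV[R]_n) (i : nat) : 'cV[R]_(m i) :=
  if i is i'.+1 then
    \col_j activ j ((weight N i' *m layer x i' + bias N i') j 0)
  else x.

(* W^{i+1} w^i + b^{i+1} *)
Definition preact (x : 'cV[R]_n) (i : nat) : 'cV[R]_(m i.+1) :=
  weight N i *m layer x i + bias N i.

Definition Znn (x : 'cV[R]_n) : 'cV[R]_n :=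
  out_weight N *m layer x k + out_bias N.

Definition differentiable_activations : Prop :=
  forall i, (i < k)%N -> forall (j : 'I_(m i.+1)) (s : R),
    derivable (activ j) s 1.

(* The entries of [alpha i] and [beta i] are alpha^{i+1}_j and beta^{i+1}_j. *)
Definition incr_sector_bounded (D : set 'cV[R]_n)
    (alpha beta : forall i, 'rV[R]_(m i.+1)) : Prop :=
  forall i, (i < k)%N -> forall j : 'I_(m i.+1),
    alpha i 0 j <= beta i 0 j /\
    forall s t : R,
      [set preact x i j 0 | x in D] s -> [set preact x i j 0 | x in D] t ->
      (activ j s - activ j t - alpha i 0 j * (s - t)) *
      (activ j s - activ j t - beta i 0 j * (s - t)) <= 0.

(* [conform_mx 0] only casts [B i] along i = j; other blocks are 0. *)
Definition blockdiag (p q : nat -> nat) (B : forall i, 'M[R]_(p i, q i)) :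
    'M[R]_(\sum_(i < k) p i, \sum_(i < k) q i) :=
  \mxblock_(i < k, j < k)
    (if i == j then conform_mx (0 : 'M[R]_(p i, q j)) (B i) else 0).

(* blockdiag(K^1 W^1, ..., K^k W^k) for K^{i+1} = diag(d i), with its row and
   column dimensions regrouped as a + m_k and n + a; Q_1 is [Qmx alpha] and
   Q_2 is [Qmx beta]. *)
Definition Qmx (k_gt1 : (1 < k)%N) (d : forall i, 'rV[R]_(m i.+1)) :
    'M[R]_(a + m k, n + a) :=
  castmx (sum_rows m k_gt1, sum_cols m k_gt1)
    (blockdiag (p := fun i => m i.+1) (q := m)
       (fun i => diag_mx (d i) *m weight N i)).

Definition U1 : 'M[R]_(n + m k, n + a + m k) :=
  col_mx (row_mx (row_mx 1%:M 0) 0)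
         (row_mx (row_mx 0    0) 1%:M).

Definition U2 : 'M[R]_((n + a) + (a + m k), n + a + m k) :=
  col_mx
    (col_mx (row_mx (row_mx 1%:M 0) 0)
            (row_mx (row_mx 0 1%:M) 0))
    (col_mx (row_mx (row_mx 0 1%:M) 0)
            (row_mx (row_mx 0    0) 1%:M)).

Definition lmi_matrix (k_gt1 : (1 < k)%N) (A P : 'M[R]_n) (gamma : R)
    (alpha beta : forall i, 'rV[R]_(m i.+1)) : 'M[R]_(n + a + m k) :=
  let Q1 := Qmx k_gt1 alpha in
  let Q2 := Qmx k_gt1 beta in
  U1^T *m block_mx (A^T *m P + P *m A + gamma *: P) (P *m out_weight N)
                   ((out_weight N)^T *m P)          0               *m U1
  + U2^T *m block_mx (- (2 *: (Q1^T *m Q2))) (Q1^T + Q2^T)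
                     (Q1 + Q2)               (- (2%:M))             *m U2.

End Network.

Definition negsemidef (R : realType) (d : nat) (M : 'M[R]_d) : Prop :=
  M^T = M /\ forall v : 'cV[R]_d, (v^T *m M *m v) 0 0 <= 0.

Definition posdef (R : realType) (d : nat) (M : 'M[R]_d) : Prop :=
  M^T = M /\ forall v : 'cV[R]_d, v != 0 -> 0 < (v^T *m M *m v) 0 0.

Definition loewner_le (R : realType) (d : nat) (B C : 'M[R]_d) : Prop :=
  negsemidef (B - C).

Section Dynamics.
Variables (R : realType) (n : nat).
Implicit Types (f : 'cV[R]_n -> 'cV[R]_n) (C : set 'cV[R]_n).

(* A solution of x' = f(x) on [0, +oo[; the values of x at negative times are
   irrelevant. For continuous f, continuity at 0 and the equation on ]0, +oo[
   give the one-sided equation at 0. *)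
Definition is_solution f (x : R -> 'cV[R]_n) : Prop :=
  derivable_oy_Rcontinuous x 0 /\ forall t : R, 0 < t -> derive1 x t = f (x t).

(* f need not be locally Lipschitz, so uniqueness of solutions is not assumed:
   forward completeness asks for a solution from each point of C, forward
   invariance that no solution starting in C leaves C. *)
Definition forward_complete f C : Prop :=
  forall x0, C x0 -> exists x, is_solution f x /\ x 0 = x0.

Definition forward_invariant f C : Prop :=
  forall x, is_solution f x -> C (x 0) -> forall t : R, 0 <= t -> C (x t).

Record is_norm (nrm : 'cV[R]_n -> R) : Prop := IsNorm {
  is_norm_triangle : forall x y, nrm (x + y) <= nrm x + nrm y;
  is_norm_scale : forall (l : R) x, nrm (l *: x) = `|l| * nrm x;
  is_norm_eq0 : forall x, nrm x = 0 -> x = 0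
}.

Definition contractive (nrm : 'cV[R]_n -> R) f C : Prop :=
  exists c rho : R, [/\ 0 < c, 0 < rho &
    forall x1 x2, is_solution f x1 -> is_solution f x2 ->
      C (x1 0) -> C (x2 0) -> forall t : R, 0 <= t ->
      nrm (x1 t - x2 t) <= c * expR (- rho * t) * nrm (x1 0 - x2 0)].

End Dynamics.

(* Main.v *)
Require Import Defs.
From HB Require Import structures.
From mathcomp Require Import all_boot all_order all_algebra.
From mathcomp Require Import all_classical all_reals all_analysis.
From mathcomp Require Import ring lra.
Set Implicit Arguments.
Unset Strict Implicit.
Unset Printing Implicit Defensive.
Import Order.TTheory GRing.Theory Num.Theory.
Import numFieldNormedType.Exports.
Local Open Scope classical_set_scope.
Local Open Scope ring_scope.

(* Let e be the difference of two solutions, dw^i that of their i-th layers, and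
   V = e^T P e. Test the matrix inequality on the vector of
   layer increments (e, dw^1, ..., dw^k). The first block gives V' + gamma V, the
   second gives -2 (y - Q_1 x)^T (y - Q_2 x) with x = (e, dw^1, ..., dw^(k-1)) and
   y = (dw^1, ..., dw^k). This is a sum over all neurons of -2 times the sector
   product, hence nonnegative, so V' <= - gamma V and V decays like
   exp(- gamma t). The given norm and sqrt V are both continuous, absolutely
   homogeneous and positive off 0, hence equivalent by compactness of the sphere,
   which gives the rate gamma / 2. *)

(** * Stacked vectors and their block offsets *)

Lemma mxcol_Rank (R : Type) (d : nat -> nat) (k : nat)
    (u : forall i, 'cV[R]_(d i)) (i : nat) (j : 'I_(d i))
    (s : 'I_(\sum_(i < k) d i)) :
  (i < k)%N -> s = (\sum_(l < i) d l + j)%N :> nat ->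
  (\mxcol_(i < k) u i) s 0 = u i j 0.
Proof.
move=> ik sE.
(* The row of entry [j] of block [i] is the total height of the earlier blocks plus [j]. Giving [s]
   by its natural number value lets it come from a cast dimension. *)
have {s sE}-> : s = @tagnat.Rank _ (fun i : 'I_k => d i) (Ordinal ik) j.
  apply/ord_inj/esym.
  rewrite (@tagnat.RankEsum _ (fun i : 'I_k => d i)) sE; congr (_ + _)%N.
  by rewrite /= (big_ord_widen _ d (ltnW ik)).
have := mxcolK (fun i : 'I_k => u i) (Ordinal ik).
by move=> /matrixP/(_ j 0); rewrite mxE.
Qed.

Lemma ord_sum_offset (d : nat -> nat) (k : nat) (s : 'I_(\sum_(i < k) d i)) :
  exists (i : nat) (j : 'I_(d i)),
    (i < k)%N /\ s = (\sum_(l < i) d l + j)%N :> nat.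
Proof.
exists (tagnat.sig1 s), (tagnat.sig2 s); split => //.
rewrite {1}[s : nat]tagnat.rect; congr (_ + _)%N.
by rewrite (big_ord_widen _ d (ltnW (ltn_ord (tagnat.sig1 s)))).
Qed.

Section Stacking.
Variables (R : Type) (d : nat -> nat) (k : nat) (k_gt1 : (1 < k)%N).
Variable u : forall i, 'cV[R]_(d i).

(* [stack_in] and [stack_out] are (u_0, ..., u_(k-1)) and (u_1, ..., u_k), the
   two halves of U_2 (u_0, ..., u_k), with the dimensions grouped as in [Qmx]. *)
Definition stack_in : 'cV[R]_(d 0 + inner_dim d k) :=
  castmx (sum_cols d k_gt1, erefl 1%N) (\mxcol_(i < k) u i).

Definition stack_out : 'cV[R]_(inner_dim d k + d k) :=
  castmx (sum_rows d k_gt1, erefl 1%N) (\mxcol_(i < k) u i.+1).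

Lemma usubmx_stack_in : usubmx stack_in = u 0.
Proof.
apply/matrixP => j z; rewrite (ord1 z) mxE castmxE cast_ord_id.
apply: (@mxcol_Rank _ d _ u) => /=; first exact: ltnW.
by rewrite big_ord0.
Qed.

(** The two stacks overlap in u_1, ..., u_(k-1), the part that [U2] repeats: a row of block i of the
    output stack is a row of block i+1 of the input stack, shifted by [d 0]. *)
Lemma stack_outE : stack_out = col_mx (dsubmx stack_in) (u k).
Proof.
have rowE (p : 'I_(inner_dim d k + d k)) i (j : 'I_(d i.+1)) :
    (i < k)%N -> p = (\sum_(l < i) d l.+1 + j)%N :> nat ->
    stack_out p 0 = u i.+1 j 0.
  move=> ik pE; rewrite castmxE cast_ord_id.
  exact: (@mxcol_Rank _ (d \o succn) k (fun i => u i.+1) i).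
have innerE : inner_dim d k = (\sum_(l < k.-1) d l.+1)%N.
  by rewrite -(prednK (ltnW k_gt1)) /inner_dim big_add1 big_mkord.
apply/matrixP => p z; rewrite (ord1 z) mxE; case: splitP => q pE.
  have [i [j [ik /= qE]]] :=
    @ord_sum_offset (d \o succn) k (cast_ord (esym (sum_rows d k_gt1)) p).
  rewrite (rowE _ i j)// !mxE castmxE cast_ord_id; apply/esym.
  (* A row of the upper part is not in the last block, whose offset alone is already
     [inner_dim d k]. *)
  have ik1 : (i.+1 < k)%N.
    rewrite ltn_neqAle ik andbT; apply/eqP => ikE.
    have : (inner_dim d k <= q)%N.
      by rewrite -pE qE innerE -ikE /= leq_addr.
    by rewrite leqNgt ltn_ord.
  apply: (@mxcol_Rank _ d _ u i.+1 j) ik1 _.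
  by rewrite big_ord_recl -addnA -[(_ + j)%N]qE pE.
(* The lower rows are block [k.-1], of height [d k.-1.+1], equal to [d k] only up to a cast; [castE]
   abstracts the index so that the cast can be rewritten away. *)
have kk : k.-1.+1 = k := prednK (ltnW k_gt1).
rewrite (rowE p k.-1 (cast_ord (f_equal d (esym kk)) q)).
- have castE k' (e : k' = k) : u k' (cast_ord (f_equal d (esym e)) q) 0 = u k q 0.
    by rewrite -> e; rewrite cast_ord_id.
  exact: castE.
- by rewrite kk.
- by rewrite pE innerE.
Qed.
End Stacking.

(** * Quadratic forms of block matrices and of the matrix inequality *)

Lemma quad_form_block (R : comPzRingType) (p q : nat) (a : 'M[R]_p)
    (b : 'M[R]_(p, q)) (c : 'M[R]_(q, p)) (e : 'M[R]_q)
    (x : 'cV[R]_p) (y : 'cV[R]_q) :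
  (col_mx x y)^T *m block_mx a b c e *m col_mx x y =
  x^T *m a *m x + y^T *m c *m x + (x^T *m b *m y + y^T *m e *m y).
Proof. by rewrite tr_col_mx mul_row_block mul_row_col !mulmxDl. Qed.

Lemma quad_form_congr (R : comPzRingType) (p q : nat) (U : 'M[R]_(p, q))
    (B : 'M[R]_p) (v : 'cV[R]_q) :
  v^T *m (U^T *m B *m U) *m v = (U *m v)^T *m B *m (U *m v).
Proof. by rewrite trmx_mul !mulmxA. Qed.

Lemma mulmx_dotC (R : comPzRingType) (p : nat) (x y : 'cV[R]_p) :
  x^T *m y = y^T *m x.
Proof. by rewrite [LHS]mx11_scalar -tr_scalar_mx -mx11_scalar trmx_mul trmxK. Qed.

(** A one-by-one product equals its transpose, so the two off-diagonal blocks contribute equal cross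
    terms and the expansion factors. *)
Lemma sector_form (R : comPzRingType) (p q : nat) (Q1 Q2 : 'M[R]_(p, q))
    (x : 'cV[R]_q) (y : 'cV[R]_p) :
  (col_mx x y)^T *m block_mx (- (2 *: (Q1^T *m Q2))) (Q1^T + Q2^T)
                             (Q1 + Q2)               (- (2%:M)) *m col_mx x y =
  - (2 *: ((y - Q1 *m x)^T *m (y - Q2 *m x))).
Proof.
rewrite quad_form_block mulmxN mulNmx -scalemxAr -scalemxAl mulmxA -trmx_mul.
rewrite mulmxN mulNmx mul_mx_scalar -scalemxAl -mulmxA.
rewrite -(mulmxA _ _ x) mulmxDl mulmxDr -(mulmxA _ _ y) mulmxDl mulmxDr.
rewrite !(mulmxA x^T) -!trmx_mul.
rewrite !(mulmx_dotC y (_ *m x)).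
have -> : (y - Q1 *m x)^T = y^T - (Q1 *m x)^T by rewrite linearB.
rewrite mulmxBl !mulmxBr (mulmx_dotC y (Q2 *m x)).
set a := (Q1 *m x)^T *m y; set b := (Q2 *m x)^T *m y.
set c := y^T *m y; set e := (Q1 *m x)^T *m (Q2 *m x).
by apply/matrixP => i j; move: a b c e => a b c e; rewrite !mxE; ring.
Qed.

Lemma blockdiag_mul_mxcol (R : realType) (k : nat) (p q : nat -> nat)
    (B : forall i, 'M[R]_(p i, q i)) (u : forall i, 'cV[R]_(q i)) :
  blockdiag k B *m \mxcol_(i < k) u i = \mxcol_(i < k) (B i *m u i).
Proof.
rewrite /blockdiag mul_mxblock_mxrow; apply: eq_mxcol => i.
rewrite (bigD1 i)//= eqxx conform_mx_id big1 ?addr0// => j /negPf ji.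
by rewrite eq_sym ji mul0mx.
Qed.

Lemma castmx_mul (R : pzSemiRingType) (p p' q q' r : nat) (ep : p = p')
    (eq : q = q') (M : 'M[R]_(p, q)) (X : 'M[R]_(q, r)) :
  castmx (ep, eq) M *m castmx (eq, erefl r) X = castmx (ep, erefl r) (M *m X).
Proof. by case: _ / ep; case: _ / eq; rewrite !castmx_id. Qed.

Lemma castmxB (V : zmodType) (p p' q : nat) (ep : p = p') (X Y : 'M[V]_(p, q)) :
  castmx (ep, erefl q) (X - Y) =
  castmx (ep, erefl q) X - castmx (ep, erefl q) Y.
Proof. by case: _ / ep; rewrite !castmx_id. Qed.

Section LmiForm.
Variables (R : realType) (n k : nat) (k_gt1 : (1 < k)%N) (N : network R n k).
Local Notation m := (layer_dim n (hidden N)).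
Local Notation a := (inner_dim m k).
Variables (A P : 'M[R]_n) (gamma : R).
Variables (alpha beta : forall i, 'rV[R]_(m i.+1)).

Lemma Qmx_mul_stack (d : forall i, 'rV[R]_(m i.+1)) (u : forall i, 'cV[R]_(m i)) :
  Qmx (N := N) k_gt1 d *m stack_in k_gt1 u =
  castmx (sum_rows m k_gt1, erefl 1%N)
    (\mxcol_(i < k) (diag_mx (d i) *m weight N i *m u i)).
Proof. by rewrite /Qmx /stack_in castmx_mul blockdiag_mul_mxcol. Qed.

Lemma mul_U1_col (x : 'cV[R]_n) (w : 'cV[R]_a) (y : 'cV[R]_(m k)) :
  U1 N *m col_mx (col_mx x w) y = col_mx x y.
Proof.
by rewrite /U1 mul_col_mx !mul_row_col !mul1mx !mul0mx !addr0 !add0r.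
Qed.

Lemma mul_U2_col (x : 'cV[R]_n) (w : 'cV[R]_a) (y : 'cV[R]_(m k)) :
  U2 N *m col_mx (col_mx x w) y = col_mx (col_mx x w) (col_mx w y).
Proof.
by rewrite /U2 !mul_col_mx !mul_row_col !mul1mx !mul0mx !addr0 !add0r.
Qed.

(** On the stacked vector, [U1] keeps the first and last layers, while [U2] yields the input stack
    over the output stack, to which [sector_form] applies. *)
Lemma lmi_form (u : forall i, 'cV[R]_(m i)) :
  let v := col_mx (stack_in k_gt1 u) (u k) in
  let sec (d : forall i, 'rV[R]_(m i.+1)) :=
    stack_out k_gt1 u - Qmx (N := N) k_gt1 d *m stack_in k_gt1 u in
  v^T *m lmi_matrix k_gt1 A P gamma alpha beta *m v =
  (u 0%N)^T *m (A^T *m P + P *m A + gamma *: P) *m u 0%N +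
  (u k)^T *m ((out_weight N)^T *m P) *m u 0%N +
  (u 0%N)^T *m (P *m out_weight N) *m u k -
  2 *: ((sec alpha)^T *m sec beta).
Proof.
move=> v sec; rewrite /lmi_matrix.
have U1v : U1 N *m v = col_mx (u 0%N) (u k).
  rewrite /v -[stack_in k_gt1 u]vsubmxK usubmx_stack_in.
  by rewrite mul_U1_col.
have U2v : U2 N *m v = col_mx (stack_in k_gt1 u) (stack_out k_gt1 u).
  by rewrite /v stack_outE -[stack_in k_gt1 u]vsubmxK mul_U2_col col_mxKd.
rewrite mulmxDr mulmxDl !quad_form_congr U1v U2v.
rewrite quad_form_block mulmx0 mul0mx addr0; congr (_ + _).
exact: (@sector_form _ _ (n + a)
  (Qmx (N := N) k_gt1 alpha) (Qmx (N := N) k_gt1 beta)).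
Qed.
End LmiForm.

(** * Comparison of homogeneous functions by compactness of the sphere *)

Section NormEquivalence.
Variables (R : realType) (n : nat).
Implicit Types f g : 'rV[R]_n -> R.

Definition abs_homogeneous f :=
  forall (l : R) v, f (l *: v) = `|l| * f v.

(* Row vectors, because [bounded_closed_compact] is only available for them. *)
Lemma homogeneous_le f g :
  continuous f -> continuous g -> abs_homogeneous f -> abs_homogeneous g ->
  (forall v, v != 0 -> 0 < g v) ->
  exists2 c : R, 0 < c & forall v, f v <= c * g v.
Proof.
move=> fc gc fh gh g0.
pose S := [set v : 'rV[R]_n | `|v| = 1].
have f00 : f 0 = 0 by rewrite -(scale0r 0) fh normr0 mul0r.
have g00 : g 0 = 0 by rewrite -(scale0r 0) gh normr0 mul0r.
have unitS v : v != 0 -> S (`|v|^-1 *: v).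
  by move=> v0; rewrite /S /= normrZ normfV normr_id mulVf// normr_eq0.
(* An empty sphere leaves only the zero vector, where both functions vanish and any constant
   works. *)
have [S0|/nonemptyPn S0] := pselect (S !=set0); last first.
  exists 1 => // v; have [->|v0] := eqVneq v 0; first by rewrite f00 g00 mulr0.
  by move: (unitS v v0); rewrite S0.
have Sc : compact S.
  apply: bounded_closed_compact.
    by exists 1; split=> // x x1 v; rewrite /S /= => ->; exact: ltW.
  have -> : S = (fun v : 'rV[R]_n => `|v|) @^-1` [set 1 : R] by [].
  by apply: preimage_closed; [move=> v _; exact: norm_continuous|exact: closed_eq].
have [x _ fx] := compact_EVT_max S0 Sc (continuous_subspaceT fc).
have [y yS gy] := compact_EVT_min S0 Sc (continuous_subspaceT gc).
have y0 : 0 < g y.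
  apply: g0; apply: contraTneq yS => ->.
  by rewrite notin_setE /S /= normr0 => /esym/eqP; rewrite oner_eq0.
(* On the sphere f is at most [f x] and g at least [g y]; the added 1 keeps the constant positive
   whatever the value of [f x]. *)
have c0 : 0 < (`|f x| + 1) / g y by rewrite divr_gt0// ltr_wpDl.
exists ((`|f x| + 1) / g y) => // v.
have [->|v0] := eqVneq v 0; first by rewrite f00 g00 mulr0.
have vS : (`|v|^-1 *: v) \in S by rewrite inE; exact: unitS.
have vN : v = `|v| *: (`|v|^-1 *: v) by rewrite scalerA divff ?scale1r// normr_eq0.
rewrite vN fh gh normr_id mulrCA ler_wpM2l//.
rewrite (le_trans (fx _ vS))// (le_trans _ (ler_wpM2l (ltW c0) (gy _ vS)))//.
by rewrite divfK ?gt_eqF// (le_trans (ler_norm _))// lerDl.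
Qed.
End NormEquivalence.

(** * Continuity of an arbitrary norm *)

Lemma normr_trmx (R : realType) (m n : nat) (M : 'M[R]_(m, n)) : `|M^T| = `|M|.
Proof.
rewrite /Num.Def.normr/= !mx_normrE (reindex (fun i => (i.2, i.1)))/=.
  by apply: eq_bigr => i _; rewrite mxE.
by exists (fun i => (i.2, i.1)) => -[].
Qed.

Lemma trmx_continuous (R : realType) (m n : nat) :
  continuous (@trmx R m n).
Proof.
move=> M; apply/(@cvgrPdist_le R _ _ (nbhs M) (nbhs_filter M)) => e e0.
have /cvgrPdist_le/(_ _ e0) ME : E @[E --> M] --> M by exact: cvg_id.
by near=> E; rewrite -raddfB normr_trmx; near: E.
Unshelve. all: by end_near. Qed.

Section NormFacts.
Variables (R : realType) (n : nat) (nrm : 'cV[R]_n -> R).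
Hypothesis nrm_norm : is_norm nrm.

Lemma is_norm0 : nrm 0 = 0.
Proof. by rewrite -(scale0r 0) (is_norm_scale nrm_norm) normr0 mul0r. Qed.

Lemma is_normN v : nrm (- v) = nrm v.
Proof. by rewrite -scaleN1r (is_norm_scale nrm_norm) normrN normr1 mul1r. Qed.

(** Nonnegativity is not a field of [is_norm]; it follows from the triangle inequality for [v] and
    [- v]. *)
Lemma is_norm_ge0 v : 0 <= nrm v.
Proof.
have := is_norm_triangle nrm_norm v (- v).
by rewrite subrr is_norm0 is_normN -mulr2n pmulrn_lge0.
Qed.

Lemma is_norm_gt0 v : v != 0 -> 0 < nrm v.
Proof.
move=> v0; rewrite lt_neqAle is_norm_ge0 andbT eq_sym.
by apply: contraNneq v0 => /(is_norm_eq0 nrm_norm) ->.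
Qed.

Lemma is_norm_dist x y : `|nrm x - nrm y| <= nrm (x - y).
Proof.
have H u v : nrm u - nrm v <= nrm (u - v).
  by rewrite lerBlDr -{1}(subrK v u) (is_norm_triangle nrm_norm).
by rewrite ler_norml H andbT lerNl opprB -(is_normN (x - y)) opprB H.
Qed.

Lemma is_norm_le_mx_norm : exists2 K : R, 0 < K & forall v, nrm v <= K * `|v|.
Proof.
pose K := \sum_(i < n) nrm (delta_mx i 0).
have K0 : 0 <= K by apply: sumr_ge0 => i _; exact: is_norm_ge0.
(* The sum [K] of the norms of the basis vectors is zero in dimension 0, hence the added 1. *)
exists (K + 1); first by rewrite ltr_wpDl.
move=> v; apply: (@le_trans _ _ (K * `|v|)); last by rewrite ler_wpM2r// lerDl.
rewrite {1}[v]matrix_sum_delta mulr_suml.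
have le_sum (I : seq 'I_n) (F : 'I_n -> 'cV[R]_n) :
    nrm (\sum_(i <- I) F i) <= \sum_(i <- I) nrm (F i).
  elim: I => [|i I IH]; first by rewrite !big_nil is_norm0.
  rewrite !big_cons (le_trans (is_norm_triangle nrm_norm _ _))//.
  by rewrite lerD2l.
apply: (le_trans (le_sum _ _)); apply: ler_sum => i _.
rewrite big_ord1 (is_norm_scale nrm_norm) mulrC ler_wpM2l ?is_norm_ge0//.
rewrite [leRHS]/Num.Def.normr/= mx_normrE.
exact: (le_bigmax _ (fun i : 'I_n * 'I_1 => `|v i.1 i.2|) (i, 0)).
Qed.

(** By the reverse triangle inequality, a norm is Lipschitz for the max norm. Transposition brings
    it to the row vectors of [homogeneous_le]. *)
Lemma is_norm_tr_continuous : continuous (fun v : 'rV[R]_n => nrm v^T).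
Proof.
have [K K0 nK] := is_norm_le_mx_norm.
move=> x; apply/(@cvgrPdist_le R _ _ (nbhs x) (nbhs_filter x)) => e e0.
have /cvgrPdist_le/(_ _ (divr_gt0 e0 K0)) xy : y @[y --> x] --> x.
  exact: cvg_id.
near=> y.
rewrite (le_trans (is_norm_dist _ _))// -raddfB (le_trans (nK _))//.
rewrite normr_trmx -ler_pdivlMl// mulrC; near: y; exact: xy.
Unshelve. all: by end_near. Qed.
End NormFacts.

(** * Continuity and derivative of the quadratic form *)

Section QuadraticForm.
Variables (R : realType) (n : nat) (P : 'M[R]_n).

Definition quad (v : 'cV[R]_n) : R := (v^T *m P *m v) 0 0.

Lemma quadE v : quad v = \sum_j (\sum_i v i 0 * P i j) * v j 0.
Proof.
rewrite /quad mxE; apply: eq_bigr => j _; rewrite mxE; congr (_ * _).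
by apply: eq_bigr => i _; rewrite mxE.
Qed.

Lemma quadZ l v : quad (l *: v) = l ^+ 2 * quad v.
Proof.
rewrite /quad; have -> : (l *: v)^T = l *: v^T by rewrite linearZ.
by rewrite -!scalemxAl -scalemxAr scalerA mxE expr2.
Qed.

Lemma cvg_quad (T : Type) (F : set_system T) (FF : Filter F)
    (v : T -> 'cV[R]_n) (l : 'cV[R]_n) :
  v @ F --> l -> quad (v x) @[x --> F] --> quad l.
Proof.
move=> vl.
have vi i : v x i 0 @[x --> F] --> l i 0.
  exact: (@cvg_comp _ _ _ v (fun M : 'cV[R]_n => M i 0) _ _ _ vl
    (@coord_continuous R _ _ i 0 l)).
rewrite quadE; under eq_fun do rewrite quadE.
apply: (cvg_big add_continuous) => j _; apply: cvgM => //.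
by apply: (cvg_big add_continuous) => i _; apply: cvgM => //; exact: cvg_cst.
Qed.

Lemma is_derive_quad (e : R -> 'cV[R]_n) (t : R) (de : 'cV[R]_n) :
  is_derive t 1 e de ->
  is_derive t 1 (quad \o e)
    ((de^T *m P *m e t + (e t)^T *m P *m de) 0 0).
Proof.
move=> ede.
have ei i : is_derive t 1 (fun s => e s i 0) (de i 0).
  have /derivable_mxP/(_ i 0) ei := @ex_derive _ _ _ _ _ _ _ ede.
  apply: DeriveDef => //.
  by rewrite -(@derive_val _ _ _ _ _ _ _ ede) derive_mx ?mxE.
(* As sums, products and scalings of the coordinate functions, the form can be differentiated by
   instance resolution. *)
have -> : quad \o e =
    \sum_j ((\sum_i (P i j \*: (fun s => e s i 0))) * (fun s => e s j 0)).
  apply/funext => s; rewrite /= quadE fct_sumE; apply: eq_bigr => j _.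
  rewrite fctE fct_sumE; congr (_ * _); apply: eq_bigr => i _.
  by rewrite mulrC.
apply: is_derive_eq.
rewrite big_split /= addrC [RHS]mxE; congr (_ + _).
  rewrite [RHS]mxE; apply: eq_bigr => j _.
  rewrite mxE mulrC; congr (_ * _); apply: eq_bigr => i _.
  by rewrite mxE mulrC.
rewrite [RHS]mxE; apply: eq_bigr => j _; congr (_ * _).
by rewrite fct_sumE mxE; apply: eq_bigr => i _; rewrite mxE mulrC.
Qed.

End QuadraticForm.

(** * Sector residuals and the Lyapunov inequality *)

Section Contraction.
Variables (R : realType) (n k : nat) (k_gt1 : (1 < k)%N) (N : network R n k).
Local Notation m := (layer_dim n (hidden N)).
Variables (D : set 'cV[R]_n) (alpha beta : forall i, 'rV[R]_(m i.+1)).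
Hypothesis sector : incr_sector_bounded D alpha beta.

Definition layer_diff (x y : 'cV[R]_n) (i : nat) : 'cV[R]_(m i) :=
  layer N x i - layer N y i.

(** For [d] equal to [alpha] and to [beta], these are the two factors of the sector condition at the
    pre-activations of [x] and [y]. *)
Definition neuron_residual (d : forall i, 'rV[R]_(m i.+1)) (x y : 'cV[R]_n)
    (i : nat) (j : 'I_(m i.+1)) : R :=
  activ j (preact N x i j 0) - activ j (preact N y i j 0)
    - d i 0 j * (preact N x i j 0 - preact N y i j 0).

Definition sector_residual (d : forall i, 'rV[R]_(m i.+1)) (x y : 'cV[R]_n) :=
  stack_out k_gt1 (layer_diff x y)
    - Qmx (N := N) k_gt1 d *m stack_in k_gt1 (layer_diff x y).

(** Biases cancel in differences, so a weight matrix maps the increment of one layer to the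
    increment of the next pre-activation. *)
Lemma sector_residualE (d : forall i, 'rV[R]_(m i.+1)) (x y : 'cV[R]_n) :
  sector_residual d x y =
  castmx (sum_rows m k_gt1, erefl 1%N)
    (\mxcol_(i < k) \col_j neuron_residual d x y j).
Proof.
rewrite /sector_residual Qmx_mul_stack /stack_out -castmxB -mxcolB; congr castmx.
apply: eq_mxcol => i; apply/matrixP => j z; rewrite (ord1 z) [LHS]mxE [RHS]mxE.
congr (_ + _); first by rewrite [LHS]mxE; congr (_ + _); rewrite mxE ?mxE.
rewrite mxE -mulmxA mul_diag_mx mxE; congr (- (_ * _)).
by rewrite /layer_diff mulmxBr /preact !mxE opprD addrACA subrr addr0.
Qed.

Lemma sector_residual_le0 (x y : 'cV[R]_n) : D x -> D y ->
  ((sector_residual alpha x y)^T *m sector_residual beta x y) 0 0 <= 0.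
Proof.
move=> Dx Dy; rewrite !sector_residualE mxE sumr_le0// => p _.
rewrite mxE !castmxE !mxE.
(* The layer and the neuron to which the stacked row belongs. *)
set i := tagnat.sig1 _; set j := tagnat.sig2 _.
have [_ sec] := sector (ltn_ord i) j.
by apply: sec; [exists x|exists y].
Qed.

Variables (A P : 'M[R]_n) (gamma : R).
Hypothesis lmi : loewner_le (lmi_matrix k_gt1 A P gamma alpha beta) 0.
Let f (x : 'cV[R]_n) := A *m x + Znn N x.

Lemma lyapunov_le (x y : 'cV[R]_n) : D x -> D y ->
  ((f x - f y)^T *m P *m (x - y) + (x - y)^T *m P *m (f x - f y)) 0 0
    <= - gamma * quad P (x - y).
Proof.
move=> Dx Dy.
have [_] := lmi; rewrite subr0.
move=> /(_ (col_mx (stack_in k_gt1 (layer_diff x y)) (layer_diff x y k))).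
rewrite lmi_form -/(sector_residual alpha x y) -/(sector_residual beta x y).
have := sector_residual_le0 Dx Dy.
rewrite /=; set r := (_^T *m _).
have -> : f x - f y = A *m (x - y) + out_weight N *m layer_diff x y k.
  rewrite /f /Znn /layer_diff !mulmxBr.
  by apply/matrixP => i j; rewrite !mxE; ring.
have -> : layer_diff x y 0%N = x - y by [].
set e := x - y; set w := layer_diff x y k; set W := out_weight N.
have -> : e^T *m (A^T *m P + P *m A + gamma *: P) *m e
    + w^T *m (W^T *m P) *m e + e^T *m (P *m W) *m w =
  ((A *m e + W *m w)^T *m P *m e + e^T *m P *m (A *m e + W *m w))
    + gamma *: (e^T *m P *m e).
  have -> : (A *m e + W *m w)^T = e^T *m A^T + w^T *m W^T.
    by rewrite linearD /= !trmx_mul.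
  rewrite !mulmxDr !mulmxDl -!scalemxAr -!scalemxAl !mulmxA.
  by apply/matrixP => i j; rewrite !mxE; ring.
move=> r0; rewrite [X in X <= 0]mxE [X in X + _]mxE [X in _ + X + _]mxE.
rewrite [X in _ + _ + X]mxE [X in _ + _ - X]mxE -/(quad P e).
by move: r0; lra.
Qed.
End Contraction.

(** * Exponential decay along solutions and the contraction estimate *)

Lemma derivable_oy_is_derive (R : realType) (V : normedModType R) (x : R -> V)
    (t : R) :
  derivable_oy_Rcontinuous x 0 -> 0 < t -> is_derive t 1 x (derive1 x t).
Proof.
move=> [dx _] t0; rewrite derive1E; apply: DeriveDef => //.
by apply: dx; rewrite in_itv /= t0.
Qed.

(** The function exp(gamma s) V(s) has nonpositive derivative for s > 0 and is right-continuous at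
    0, hence is nonincreasing on [0, t]. Asking for no derivative at 0 matches [is_solution]. *)
Lemma gronwall_le (R : realType) (V dV : R -> R) (gamma : R) :
  V @ 0^'+ --> V 0 ->
  (forall t : R, 0 < t -> is_derive t 1 V (dV t)) ->
  (forall t : R, 0 < t -> dV t <= - gamma * V t) ->
  forall t : R, 0 <= t -> V t <= expR (- gamma * t) * V 0.
Proof.
move=> V0 Vd Vle t t0.
pose g s := V s * expR (gamma * s).
have gd (s : R) : 0 < s -> is_derive s 1 g (expR (gamma * s) * (dV s + gamma * V s)).
  move=> s0; have Vds := Vd _ s0.
  have Ed : is_derive s 1 (fun s => expR (gamma * s)) (expR (gamma * s) * gamma).
    have := @is_derive1_comp _ expR (fun s => gamma * s) s _ _
      (is_derive_expR _) (is_deriveZ gamma (is_derive_id s 1)).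
    by rewrite /GRing.scale /= mulr1.
  apply: (is_derive_eq (is_deriveM Vds Ed)).
  rewrite /GRing.scale /=; ring.
have g_bnd : derivable_oy_Rcontinuous g 0.
  split=> [s|].
    rewrite in_itv /= andbT => s0.
    exact: (@ex_derive _ _ _ _ _ _ _ (gd _ s0)).
  apply: cvgM => //; apply: cvg_at_right_filter.
  apply: (@continuous_comp _ _ _ ( *%R gamma) expR).
    exact: mulrl_continuous.
  exact: continuous_expR.
have gle : g t <= g 0.
  have gc : {within `[0, t], continuous g}.
    apply: (continuous_subspaceW _ (derivable_oy_Rcontinuous_within_itvcy g_bnd)).
    by move=> s /=; rewrite !in_itv /= => /andP[->].
  apply: (@ler0_derive1_le_cc _ g 0 t) => //.
  - move=> s; rewrite in_itv /= => /andP[s0 _].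
    exact: (@ex_derive _ _ _ _ _ _ _ (gd _ s0)).
  - move=> s; rewrite in_itv /= => /andP[s0 _]; have gs := gd _ s0.
    rewrite derive1E derive_val mulr_ge0_le0 ?expR_ge0//.
    by rewrite -lerBrDr sub0r -mulNr Vle.
  - by rewrite in_itv /= lexx t0.
  - by rewrite in_itv /= lexx t0.
rewrite mulNr expRN mulrC ler_pdivlMr ?expR_gt0//.
by move: gle; rewrite /g mulr0 expR0 mulr1.
Qed.

Theorem mainTheorem3 (R : realType) (n k : nat) (k_gt1 : (1 < k)%N)
    (nrm : 'cV[R]_n -> R) (nrm_norm : is_norm nrm)
    (A : 'M[R]_n) (N : network R n k) (D C : set 'cV[R]_n)
    (alpha beta : forall i, 'rV[R]_(layer_dim n (hidden N) i.+1))
    (act_diff : differentiable_activations N)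
    (sector : incr_sector_bounded D alpha beta)
    (C_sub_D : C `<=` D)
    (C_complete : forward_complete (fun x => A *m x + Znn N x) C)
    (C_invariant : forward_invariant (fun x => A *m x + Znn N x) C)
    (lmi : exists (P : 'M[R]_n) (p_lo p_hi gamma : R),
      [/\ posdef P, [/\ 0 < p_lo, 0 < p_hi & 0 < gamma],
          loewner_le p_lo%:M P, loewner_le P p_hi%:M &
          loewner_le (lmi_matrix k_gt1 A P gamma alpha beta) 0]) :
  contractive nrm (fun x => A *m x + Znn N x) C.
Proof.
have [P [_ [_ [gamma [[_ P_gt0] [_ _ gamma_gt0] _ _ P_lmi]]]]] := lmi.
(* The square root makes the form homogeneous of degree one, hence comparable with a norm. *)
pose energy (v : 'rV[R]_n) := Num.sqrt (quad P v^T).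
pose nrmT (v : 'rV[R]_n) := nrm v^T.
have energy_c : continuous energy.
  move=> v.
  apply: (@continuous_comp _ _ _ (fun v : 'rV[R]_n => quad P v^T) Num.sqrt).
    apply: (@cvg_quad _ _ P _ (nbhs v) _ (fun v : 'rV[R]_n => v^T) v^T).
    exact: trmx_continuous.
  exact: sqrt_continuous.
have energyZ : abs_homogeneous energy.
  move=> l v; rewrite /energy linearZ /= quadZ sqrtrM ?sqr_ge0//.
  by rewrite sqrtr_sqr.
have nrmZ : abs_homogeneous nrmT.
  by move=> l v; rewrite /nrmT linearZ /= (is_norm_scale nrm_norm).
have trmx_neq0 (v : 'rV[R]_n) : v != 0 -> v^T != 0.
  by apply: contra_neq => v0; rewrite -[v]trmxK v0 trmx0.
have energy_gt0 v : v != 0 -> 0 < energy v.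
  by move=> /trmx_neq0 v0; rewrite sqrtr_gt0 P_gt0.
have nrm_gt0 v : v != 0 -> 0 < nrmT v.
  by move=> /trmx_neq0 v0; exact: is_norm_gt0.
have nrm_c := is_norm_tr_continuous nrm_norm.
have [c1 c1_gt0 nrm_le] :=
  homogeneous_le nrm_c energy_c nrmZ energyZ energy_gt0.
have [c2 c2_gt0 energy_le] :=
  homogeneous_le energy_c nrm_c energyZ nrmZ nrm_gt0.
(* One constant for each passage between the norm and the energy; the rate is halved by the square
   root. *)
exists (c1 * c2), (gamma / 2); split; [exact: mulr_gt0|exact: divr_gt0|].
move=> x1 x2 x1_sol x2_sol Cx1 Cx2 t t0.
(* Invariance keeps both solutions in [C], hence in [D], where the sector bounds hold. *)
have x1C := C_invariant _ x1_sol Cx1; have x2C := C_invariant _ x2_sol Cx2.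
have [[x1_bnd x1_eq] [x2_bnd x2_eq]] := (x1_sol, x2_sol).
have decay := @gronwall_le R (quad P \o (x1 - x2))
  (fun s => ((derive1 x1 s - derive1 x2 s)^T *m P *m (x1 s - x2 s) +
             (x1 s - x2 s)^T *m P *m (derive1 x1 s - derive1 x2 s)) 0 0) gamma.
have {}decay : quad P (x1 t - x2 t) <=
    expR (- gamma * t) * quad P (x1 0 - x2 0).
  apply: decay t0 => [|s s0|s s0].
  - apply: cvg_quad; apply: cvgB; [exact: x1_bnd.2|exact: x2_bnd.2].
  - apply: is_derive_quad; apply: is_deriveB; exact: derivable_oy_is_derive.
  - rewrite x1_eq// x2_eq//; apply: (lyapunov_le sector P_lmi);
      apply: C_sub_D; [apply: x1C|apply: x2C]; exact: ltW.
(* The norm at time t is at most c1 sqrt V(t), which decay bounds by c1 exp(- gamma t / 2) sqrt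
   V(0), and sqrt V(0) is at most c2 times the initial norm. *)
rewrite -[x1 t - x2 t]trmxK -[x1 0 - x2 0]trmxK.
apply: (le_trans (nrm_le _)); rewrite -!mulrA ler_pM2l// mulrCA.
apply: le_trans (ler_wpM2l (expR_ge0 _) (energy_le _)).
have -> : expR (- (gamma / 2) * t) = Num.sqrt (expR (- gamma * t)).
  have -> : - gamma * t = - (gamma / 2) * t + - (gamma / 2) * t by field.
  by rewrite expRD -expr2 sqrtr_sqr ger0_norm ?expR_ge0.
by rewrite -sqrtrM ?expR_ge0// ler_wsqrtr// !trmxK.
Qed.
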